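(* If $f:N\to E^4$ is a doubly slant immersion of an oriented surface $N$, then $G=G^D=0$ identically, where $G$ is the Gauss curvature and $G^D$ the normal curvature of $f$.
   Context: $E^4$ is oriented Euclidean $4$-space. $\mathcal J$ is the set of linear $J:E^4\to E^4$ with $J^2=-I$ and $\langle JX,JY\rangle=\langle X,Y\rangle$. A $J$-basis is an orthonormal basis $e_1,\dots,e_4$ with $Je_1=e_2$, $Je_3=e_4$; $\mathcal J^+$ (resp. $\mathcal J^-$) is the set of $J\in\mathcal J$ whose $J$-bases are positive (resp. negative). For an oriented $2$-plane $V$ with positive orthonormal basis $e_1,e_2$ put $\alpha_J(V)=\cos^{-1}\langle Je_1,e_2\rangle\in[0,\pi]$; $f$ is slant with respect to $J$ if $\alpha_J(T_pN)$ is constant in $p\in N$. $f$ is doubly slant if it is slant with respect to some $J^+\in\mathcal J^+$ and at the same time slant with respect to some $J^-\in\mathcal J^-$. The normal curvature is, for a local orthonormal frame with $e_1,e_2$ tangent, $e_3,e_4$ normal and $h^r_{ij}=\langle h(e_i,e_j),e_r\rangle$ ($h$ the second fundamental form), $G^D=h^3_{11}h^4_{12}+h^3_{12}h^4_{22}-h^3_{12}h^4_{11}-h^3_{22}h^4_{12}$ (its vanishing does not depend on the frame). *)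

(* Defs.v *)
From HB Require Import structures.
From mathcomp Require Import all_boot all_order all_algebra.
From mathcomp Require Import all_classical all_reals all_analysis.

Set Implicit Arguments.
Unset Strict Implicit.
Unset Printing Implicit Defensive.

Import Order.TTheory GRing.Theory Num.Theory.
Import numFieldNormedType.Exports.

Local Open Scope classical_set_scope.
Local Open Scope ring_scope.

(* E^4 is 'rV[R]_4 with the inner
   product dot and the orientation of the canonical basis.  The library norm of
   'rV[R]_n is the sup norm; it is only used through its topology. *)

Definition dot (R : realType) (n : nat) (u v : 'rV[R]_n) : R :=
  (u *m v^T) 0 0.

Definition orthonormal_rows (R : realType) (k n : nat) (E : 'M[R]_(k, n)) :
    Prop :=
  forall i j : 'I_k, dot (row i E) (row j E) = (i == j)%:R.

(* For U open and finite-dimensional source, this is the usual class C^k. *)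
Fixpoint class_C (R : realType) (m n : nat) (k : nat) (U : set 'rV[R]_m)
    (F : 'rV[R]_m -> 'rV[R]_n) {struct k} : Prop :=
  match k with
  | 0%N => forall x, U x -> {for x, continuous F}
  | k'.+1 => (forall x, U x -> differentiable F x) /\
             (forall v : 'rV[R]_m, class_C k' U ('D_v F))
  end.

Definition smooth_on (R : realType) (m n : nat) (U : set 'rV[R]_m)
    (F : 'rV[R]_m -> 'rV[R]_n) : Prop :=
  forall k, class_C k U F.

(* A chart is a homeomorphism cmap from the open set cdom onto an open subset
   of the plane; outside cdom (resp. its image) the total functions cmap and
   cinv carry no information. *)
Record chart (R : realType) (T : topologicalType) := Chart {
  cdom : set T;
  cmap : T -> 'rV[R]_2;
  cinv : 'rV[R]_2 -> T;
  cdom_open : open cdom;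
  cimage_open : open (cmap @` cdom);
  cmapK : forall p, cdom p -> cinv (cmap p) = p;
  cmap_continuous : {within cdom, continuous cmap};
  cinv_continuous : {within cmap @` cdom, continuous cinv}
}.

Record oriented_surface (R : realType) := OrientedSurface {
  points :> topologicalType;
  surface_hausdorff : hausdorff_space points;
  surface_second_countable : @second_countable points;
  atlas : set (chart R points);
  atlas_cover : forall p, exists2 c, atlas c & cdom c p;
  atlas_smooth : forall c d, atlas c -> atlas d ->
    smooth_on (cmap c @` (cdom c `&` cdom d)) (cmap d \o cinv c);
  atlas_oriented : forall c d, atlas c -> atlas d ->
    forall p, cdom c p -> cdom d p ->
    0 < \det ('J (cmap d \o cinv c) (cmap c p))
}.

Section Immersions.
Variables (R : realType) (N : oriented_surface R) (f : N -> 'rV[R]_4).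

Definition local_rep (c : chart R N) : 'rV[R]_2 -> 'rV[R]_4 := f \o cinv c.

Definition immersion : Prop :=
  forall c, atlas c ->
    smooth_on (cmap c @` cdom c) (local_rep c) /\
    forall p, cdom c p -> injective ('d (local_rep c) (cmap c p)).

(* The rows of the Jacobian 'J (local_rep c) x are the coordinate tangent
   vectors, and they form a positive basis of the tangent plane. *)
Definition positive_tangent_basis (p : N) (E : 'M[R]_(2, 4)) : Prop :=
  exists c : chart R N, [/\ atlas c, cdom c p &
    exists2 A : 'M[R]_2, 0 < \det A & E = A *m 'J (local_rep c) (cmap c p)].

End Immersions.

Section ComplexStructures.
Variable R : realType.
Implicit Type J : {linear 'rV[R]_4 -> 'rV[R]_4}.

Definition compatible_complex_structure J : Prop :=
  (forall X, J (J X) = - X) /\ (forall X Y, dot (J X) (J Y) = dot X Y).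

(* The rows of E are e_1, ..., e_4. *)
Definition J_basis J (E : 'M[R]_4) : Prop :=
  [/\ orthonormal_rows E, J (row 0 E) = row 1 E & J (row 2 E) = row 3 E].

Definition J_plus J : Prop :=
  compatible_complex_structure J /\ (forall E, J_basis J E -> 0 < \det E).

Definition J_minus J : Prop :=
  compatible_complex_structure J /\ (forall E, J_basis J E -> \det E < 0).

(* alpha_J of the oriented plane with positive orthonormal basis the rows of
   E; its value does not depend on that basis. *)
Definition alpha J (E : 'M[R]_(2, 4)) : R :=
  acos (dot (J (row 0 E)) (row 1 E)).

Definition slant (N : oriented_surface R) (f : N -> 'rV[R]_4) J : Prop :=
  exists theta : R, forall p E,
    positive_tangent_basis f p E -> orthonormal_rows E -> alpha J E = theta.

Definition doubly_slant (N : oriented_surface R) (f : N -> 'rV[R]_4) : Prop :=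
  (exists2 J : {linear 'rV[R]_4 -> 'rV[R]_4}, J_plus J & slant f J) /\
  (exists2 J : {linear 'rV[R]_4 -> 'rV[R]_4}, J_minus J & slant f J).

End ComplexStructures.

Definition pd (R : realType) (V : normedModType R) (i : 'I_2)
    (u : 'rV[R]_2 -> V) : 'rV[R]_2 -> V :=
  'D_(delta_mx 0 i) u.

(* Intrinsic curvature of a Riemannian metric g given in local coordinates. *)
Section GaussCurvature.
Variables (R : realType) (g : 'rV[R]_2 -> 'M[R]_2).

(* Levi-Civita connection: nabla_i d_j = sum_k christoffel k i j d_k. *)
Definition christoffel (k i j : 'I_2) (x : 'rV[R]_2) : R :=
  2^-1 * \sum_(l < 2) invmx (g x) k l *
    (pd i (fun y => g y j l) x + pd j (fun y => g y i l) x
     - pd l (fun y => g y i j) x).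

(* R(d_i, d_j) d_k = sum_l riemann l k i j d_l, where
   R(X, Y) = [nabla_X, nabla_Y] - nabla_[X, Y]. *)
Definition riemann (l k i j : 'I_2) (x : 'rV[R]_2) : R :=
  pd i (christoffel l j k) x - pd j (christoffel l i k) x
  + \sum_(m < 2) (christoffel l i m x * christoffel m j k x
                  - christoffel l j m x * christoffel m i k x).

(* g(R(d_1, d_2) d_2, d_1) / det g, positive on round spheres. *)
Definition gauss_curvature (x : 'rV[R]_2) : R :=
  (\sum_(l < 2) g x 0 l * riemann l 1 0 1 x) / \det (g x).

End GaussCurvature.

Section LocalImmersion.
Variables (R : realType) (F : 'rV[R]_2 -> 'rV[R]_4).

Definition induced_metric (x : 'rV[R]_2) : 'M[R]_2 :=
  \matrix_(i < 2, j < 2) dot (pd i F x) (pd j F x).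

(* Component of w orthogonal to the span of the (independent) rows of T. *)
Definition normal_part (T : 'M[R]_(2, 4)) (w : 'rV[R]_4) : 'rV[R]_4 :=
  w - w *m T^T *m invmx (T *m T^T) *m T.

(* h(dF v, dF w): the normal component of the derivative, in the direction v,
   of the tangent field extending dF w with constant coordinates. *)
Definition second_fundamental_form (x v w : 'rV[R]_2) : 'rV[R]_4 :=
  normal_part ('J F x) ('D_v ('D_w F) x).

(* The tangent vectors e_1, e_2 are the rows of A *m 'J F x, so that A holds
   their coordinates; the normal vectors e_3, e_4 are the rows of X. *)
Definition orthonormal_frame (x : 'rV[R]_2) (A : 'M[R]_2) (X : 'M[R]_(2, 4)) :
    Prop :=
  [/\ orthonormal_rows (A *m 'J F x), orthonormal_rows X &
      'J F x *m X^T = 0].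

Definition normal_curvature (x : 'rV[R]_2) (A : 'M[R]_2)
    (X : 'M[R]_(2, 4)) : R :=
  let h (r i j : 'I_2) :=
    dot (second_fundamental_form x (row i A) (row j A)) (row r X) in
  h 0 0 0 * h 1 0 1 + h 0 0 1 * h 1 1 1
  - h 0 0 1 * h 1 0 0 - h 0 1 1 * h 1 0 1.

End LocalImmersion.

(* Main.v *)
(** The slope of the tangent plane is measured by the bivector S = f_u /\ f_v,
    whose self-dual and anti-self-dual parts S_+, S_- both have squared norm
    det g.  A compatible J in J^+ (resp. J^-) is a unit vector n in the space of
    self-dual (resp. anti-self-dual) forms, and slantness says that the angle
    between n and S_+ (resp. S_-) is constant.  Hence both Gauss maps
    S_+/|S_+| and S_-/|S_-| take their values in circles, so that their
    Jacobians vanish; up to sign and scaling these Jacobians are G + G^D and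
    G - G^D. *)

Require Import Defs.
From HB Require Import structures.
From mathcomp Require Import all_boot all_order all_algebra.
From mathcomp Require Import all_classical all_reals all_analysis.
From mathcomp Require Import ring lra.

Import Order.TTheory GRing.Theory Num.Theory.
Import numFieldNormedType.Exports.

Local Open Scope classical_set_scope.
Local Open Scope ring_scope.

Set Implicit Arguments.
Unset Strict Implicit.
Unset Printing Implicit Defensive.

(** The Gauss maps are never normalised. For S = S_+ or S_-, the Jacobian of S/|S| is det(S, S_u,
    S_v)/|S|^3, so it is enough that this determinant vanishes. Slantness enters only squared, as
    <n, S>^2 = c |S|^2 with c the squared cosine of the slant angle, so that no square root of det g
    is ever differentiated. The determinant is a polynomial in f_u, f_v, f_uu, f_uv, f_vv, namely e
    [gauss_term] + [normal_term] with e = 1 or -1; two signs give two independent relations. The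
    remaining work is to recognise the two terms as curvatures: G is defined intrinsically by
    Christoffel symbols, which calls for the theorema egregium, and G^D by an arbitrary orthonormal
    frame, which has to be compared with the coordinate derivatives. *)

(** * Sums and determinants of small size *)

Lemma sum_ord2 (R : nmodType) (f : 'I_2 -> R) : \sum_(i < 2) f i = f 0 + f 1.
Proof.
by rewrite !big_ord_recl big_ord0 addr0; congr (_ + f _); apply: val_inj.
Qed.

Lemma sum_ord3 (R : nmodType) (f : 'I_3 -> R) :
  \sum_(i < 3) f i = f 0 + f 1 + f 2.
Proof.
rewrite !big_ord_recl big_ord0 addr0 addrA.
by congr (_ + f _ + f _); apply: val_inj.
Qed.

Lemma sum_ord4 (R : nmodType) (f : 'I_4 -> R) :
  \sum_(i < 4) f i = f 0 + f 1 + f 2 + f 3.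
Proof.
rewrite !big_ord_recl big_ord0 addr0 !addrA.
by congr (_ + f _ + f _ + f _); apply: val_inj.
Qed.

Lemma ord2_cases (i : 'I_2) : i = 0 \/ i = 1.
Proof. by case: i => [[|[|//]]] ?; [left|right]; apply: val_inj. Qed.

Lemma ord3_cases (i : 'I_3) : [\/ i = 0, i = 1 | i = 2].
Proof.
by case: i => [[|[|[|//]]] ?]; [apply: Or31|apply: Or32|apply: Or33];
  apply: val_inj.
Qed.

Lemma ord4_cases (i : 'I_4) : [\/ i = 0, i = 1, i = 2 | i = 3].
Proof.
by case: i => [[|[|[|[|//]]]] ?];
  [apply: Or41|apply: Or42|apply: Or43|apply: Or44]; apply: val_inj.
Qed.

Lemma det_ord2 (R : comNzRingType) (A : 'M[R]_2) :
  \det A = A 0 0 * A 1 1 - A 0 1 * A 1 0.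
Proof.
rewrite (expand_det_row _ 0) sum_ord2 /cofactor !det_mx11 !mxE /= expr0 expr1.
rewrite mul1r mulN1r mulrN.
by congr (_ * A _ _ - _ * A _ _); apply: val_inj.
Qed.

(** * The Euclidean inner product *)

Section Dot.
Variables (R : realType) (n : nat).
Implicit Types u v w : 'rV[R]_n.

Lemma dotE u v : dot u v = \sum_(i < n) u 0 i * v 0 i.
Proof. by rewrite /dot mxE; apply: eq_bigr => i _; rewrite mxE. Qed.

Lemma dotC u v : dot u v = dot v u.
Proof. by rewrite !dotE; apply: eq_bigr => i _; rewrite mulrC. Qed.

Lemma dotDl u v w : dot (u + v) w = dot u w + dot v w.
Proof. by rewrite /dot mulmxDl mxE. Qed.

Lemma dotZl a u w : dot (a *: u) w = a * dot u w.
Proof. by rewrite /dot -scalemxAl mxE. Qed.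

Lemma dotNl u w : dot (- u) w = - dot u w.
Proof. by rewrite -scaleN1r dotZl mulN1r. Qed.

Lemma dotBl u v w : dot (u - v) w = dot u w - dot v w.
Proof. by rewrite dotDl dotNl. Qed.

Lemma dot0l u : dot 0 u = 0.
Proof. by rewrite -(scale0r 0) dotZl mul0r. Qed.

Lemma dotDr u v w : dot w (u + v) = dot w u + dot w v.
Proof. by rewrite dotC dotDl !(dotC w). Qed.

Lemma dotZr a u w : dot w (a *: u) = a * dot w u.
Proof. by rewrite dotC dotZl dotC. Qed.

Lemma dotBr u v w : dot w (u - v) = dot w u - dot w v.
Proof. by rewrite dotC dotBl !(dotC w). Qed.

Lemma dot_ge0 u : 0 <= dot u u.
Proof. by rewrite dotE sumr_ge0// => i _; rewrite -expr2 sqr_ge0. Qed.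

Lemma dot_eq0 u : (dot u u == 0) = (u == 0).
Proof.
apply/eqP/eqP => [|->]; last by rewrite dotE big1// => i _; rewrite mxE mul0r.
rewrite dotE => /psumr_eq0P E; apply/rowP => i; rewrite mxE.
by apply/eqP; rewrite -sqrf_eq0 expr2 E// => j _; rewrite -expr2 sqr_ge0.
Qed.
End Dot.

(** * Self-dual and anti-self-dual parts of bivectors *)

Section SelfDual.
Variable R : realType.
Implicit Types (e : R) (x y p q r : 'rV[R]_4) (u v w : 'rV[R]_3).

Lemma dot3E u v : dot u v = u 0 0 * v 0 0 + u 0 1 * v 0 1 + u 0 2 * v 0 2.
Proof. by rewrite dotE sum_ord3. Qed.

Lemma dot4E x y :
  dot x y = x 0 0 * y 0 0 + x 0 1 * y 0 1 + x 0 2 * y 0 2 + x 0 3 * y 0 3.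
Proof. by rewrite dotE sum_ord4. Qed.

Definition det3 u v w : R :=
  u 0 0 * (v 0 1 * w 0 2 - v 0 2 * w 0 1)
  - u 0 1 * (v 0 0 * w 0 2 - v 0 2 * w 0 0)
  + u 0 2 * (v 0 0 * w 0 1 - v 0 1 * w 0 0).

(** Cramer's rule: each [n 0 k * det3 u v w] is a combination of the three inner products with
    cofactors as coefficients, so a nonzero determinant would force [n = 0]. *)
Lemma det3_orthogonal n u v w : n != 0 ->
  dot n u = 0 -> dot n v = 0 -> dot n w = 0 -> det3 u v w = 0.
Proof.
move=> n0 nu nv nw; apply/eqP; apply: contraNT n0 => d0.
apply/eqP/rowP => k; rewrite mxE; apply: (mulIf d0); rewrite mul0r.
have [->|->|->] := ord3_cases k.
- transitivity (dot n u * (v 0 1 * w 0 2 - v 0 2 * w 0 1)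
     + dot n v * (w 0 1 * u 0 2 - w 0 2 * u 0 1)
     + dot n w * (u 0 1 * v 0 2 - u 0 2 * v 0 1)).
    by rewrite /det3 !dot3E; ring.
  by rewrite nu nv nw !mul0r !addr0.
- transitivity (dot n u * (v 0 2 * w 0 0 - v 0 0 * w 0 2)
     + dot n v * (w 0 2 * u 0 0 - w 0 0 * u 0 2)
     + dot n w * (u 0 2 * v 0 0 - u 0 0 * v 0 2)).
    by rewrite /det3 !dot3E; ring.
  by rewrite nu nv nw !mul0r !addr0.
- transitivity (dot n u * (v 0 0 * w 0 1 - v 0 1 * w 0 0)
     + dot n v * (w 0 0 * u 0 1 - w 0 1 * u 0 0)
     + dot n w * (u 0 0 * v 0 1 - u 0 1 * v 0 0)).
    by rewrite /det3 !dot3E; ring.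
  by rewrite nu nv nw !mul0r !addr0.
Qed.

Lemma det3_collinear n u a b : det3 u (a *: n) (b *: n) = 0.
Proof. by rewrite /det3 !mxE; ring. Qed.

Definition wedge (i j : 'I_4) x y : R := x 0 i * y 0 j - x 0 j * y 0 i.

(* For e = 1 (resp. e = -1), the self-dual (resp. anti-self-dual) part of the
   bivector x /\ y, scaled by sqrt 2. *)
Definition dual_part e x y : 'rV[R]_3 :=
  \row_k match val k with
         | 0 => wedge 0 1 x y + e * wedge 2 3 x y
         | 1 => wedge 0 2 x y - e * wedge 1 3 x y
         | _ => wedge 0 3 x y + e * wedge 1 2 x y
         end.

Definition gram x y : R := dot x x * dot y y - dot x y ^+ 2.

(** The squared Plücker coordinates add up to [gram x y] (Lagrange's identity), and the cross terms
    are 2e times the Plücker relation p01 p23 - p02 p13 + p03 p12 = 0 of a decomposable bivector. *)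
Lemma dot_dual_part e x y : e ^+ 2 = 1 ->
  dot (dual_part e x y) (dual_part e x y) = gram x y.
Proof.
move=> /eqP; rewrite sqrf_eq1 /gram dot3E !dot4E !mxE /wedge.
by case/orP => /eqP -> /=; ring.
Qed.

(* vol x y p q = det (x, y, p, q), by Laplace expansion along two rows. *)
Definition vol x y p q : R :=
  wedge 0 1 x y * wedge 2 3 p q - wedge 0 2 x y * wedge 1 3 p q
  + wedge 0 3 x y * wedge 1 2 p q + wedge 1 2 x y * wedge 0 3 p q
  - wedge 1 3 x y * wedge 0 2 p q + wedge 2 3 x y * wedge 0 1 p q.

(* gram x y times the inner product of the components of p and q orthogonal to
   x and y. *)
Definition normal_gram x y p q : R :=
  gram x y * dot p q - dot p x * dot q x * dot y y + dot p x * dot q y * dot x y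
  + dot p y * dot q x * dot x y - dot p y * dot q y * dot x x.

(* If x, y are the first and p, q, r the second partial derivatives (11, 12,
   22) of an immersion, then gauss_term is (det g)^2 G and normal_term is, up to
   the orientation of the normal frame, (det g)^2 G^D. *)
Definition gauss_term x y p q r : R :=
  normal_gram x y p r - normal_gram x y q q.

Definition normal_term x y p q r : R :=
  dot y y * vol x y p q - dot x y * vol x y p r + dot x x * vol x y q r.

(* Jacobian of the (anti-)self-dual Gauss map. *)
Lemma det3_dual_part e x y p q r : e ^+ 2 = 1 ->
  det3 (dual_part e x y) (dual_part e p y + dual_part e x q)
    (dual_part e q y + dual_part e x r)
  = e * gauss_term x y p q r + normal_term x y p q r.
Proof.
move=> /eqP; rewrite sqrf_eq1.
rewrite /det3 !mxE /gauss_term /normal_term /normal_gram /gram /vol !dot4E.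
rewrite /wedge.
by case/orP => /eqP -> /=; ring.
Qed.
End SelfDual.

(** * Mean values along lines and symmetry of second derivatives *)

Section Calc.
Variables (R : realType) (V : normedModType R).
Implicit Types (f : V -> R) (x v w : V).

Lemma is_derive_line f (d : R) x v (s : R) :
  is_derive (s *: v + x) v f d -> is_derive s 1 (fun t => f (t *: v + x)) d.
Proof.
have E : (fun h : R => h^-1 *: (((fun t => f (t *: v + x)) \o shift s) (h *: 1)
                                - f (s *: v + x)))
  = (fun h => h^-1 *: ((f \o shift (s *: v + x)) (h *: v) - f (s *: v + x))).
  by apply/funext => h /=; rewrite [h%:A]mulr1 scalerDl addrA.
move=> [df <-]; split; first by rewrite /derivable E.
by rewrite /derive E.
Qed.

Lemma line_increment f f' x v (h : R) : 0 < h ->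
  (forall s, 0 <= s <= h -> is_derive (s *: v + x) v f (f' (s *: v + x))) ->
  exists2 s, 0 < s < h & f (h *: v + x) - f x = h * f' (s *: v + x).
Proof.
move=> h0 df.
have dg s : 0 <= s <= h ->
    is_derive s 1 (fun t => f (t *: v + x)) (f' (s *: v + x)).
  by move=> sh; apply: is_derive_line; exact: df.
have dgo s : s \in `]0, h[%R ->
    is_derive s 1 (fun t => f (t *: v + x)) (f' (s *: v + x)).
  by rewrite in_itv /= => /andP[s0 sh]; apply: dg; rewrite !ltW.
have gc : {within `[0, h], continuous (fun t => f (t *: v + x))}.
  apply: derivable_within_continuous => s; rewrite in_itv /= => sh.
  by have [] := dg s sh.
have [s sh E] := MVT h0 dgo gc.
exists s; first by rewrite in_itv in sh.
by rewrite subr0 scale0r add0r mulrC in E.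
Qed.

(** The mean value theorem is applied along [v] to the increment [f (h *: w + y) - f y], then along
    [w] to [fv]. The left side of the equation is symmetric in [v] and [w]. *)
Lemma second_difference f fv fvw x v w (h : R) : 0 < h ->
  (forall s t, 0 <= s <= h -> 0 <= t <= h ->
     is_derive (s *: v + (t *: w + x)) v f (fv (s *: v + (t *: w + x))) /\
     is_derive (s *: v + (t *: w + x)) w fv (fvw (s *: v + (t *: w + x)))) ->
  exists s t, [/\ 0 < s < h, 0 < t < h &
    f (h *: v + (h *: w + x)) - f (h *: w + x) - (f (h *: v + x) - f x)
    = h ^+ 2 * fvw (s *: v + (t *: w + x))].
Proof.
move=> h0 df.
have hh : 0 <= h <= h by rewrite lexx ltW.
have h00 : (0 : R) <= 0 <= h by rewrite lexx ltW.
pose g y := f (h *: w + y) - f y.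
pose g' y := fv (h *: w + y) - fv y.
have shift (u : V) (k : V -> R) y d : is_derive (h *: w + y) u k d ->
    is_derive y u (fun y => k (h *: w + y)) d.
  have E : (fun t : R => t^-1 *: (((fun y => k (h *: w + y)) \o shift y)
                                    (t *: u) - k (h *: w + y)))
    = (fun t => t^-1 *: ((k \o shift (h *: w + y)) (t *: u) - k (h *: w + y))).
    by apply/funext => t /=; rewrite addrCA.
  move=> [dk <-]; split; first by rewrite /derivable E.
  by rewrite /derive E.
have dg s : 0 <= s <= h -> is_derive (s *: v + x) v g (g' (s *: v + x)).
  move=> sh; apply: is_deriveB.
    by apply: shift; have [] := df s h sh hh; rewrite addrCA.
  by have [] := df s 0 sh h00; rewrite scale0r add0r.
have [s sh E] := line_increment h0 dg.
have sh' : 0 <= s <= h by case/andP: sh => *; rewrite !ltW.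
have dh t : 0 <= t <= h ->
    is_derive (t *: w + (s *: v + x)) w fv (fvw (t *: w + (s *: v + x))).
  by move=> th; rewrite addrCA; have [] := df s t sh' th.
have [t th E2] := line_increment h0 dh.
exists s, t; split=> //.
have -> : f (h *: v + (h *: w + x)) - f (h *: w + x) - (f (h *: v + x) - f x)
    = g (h *: v + x) - g x.
  by rewrite /g addrCA; ring.
by rewrite E /g' E2 addrCA expr2 mulrA.
Qed.

Lemma near_square (P : set V) x v w : (\forall y \near x, P y) ->
  \forall h \near 0^'+, forall s t : R,
    0 <= s <= h -> 0 <= t <= h -> P (s *: v + (t *: w + x)).
Proof.
move=> /nbhs_ballP[e /= e0 eP].
near=> h => s t /andP[s0 sh] /andP[t0 th]; apply: eP.
rewrite -ball_normE /=.
have h0 : 0 < h by [].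
rewrite (_ : _ - _ = - (s *: v + t *: w)); last first.
  by rewrite addrA opprD addrCA subrr addr0.
rewrite normrN (le_lt_trans (ler_normD _ _))// !normrZ !ger0_norm//.
apply: (@le_lt_trans _ _ (h * (`|v| + `|w|))).
  by rewrite mulrDr lerD// ler_wpM2r.
(* The added 1 keeps the divisor positive when [v] and [w] both vanish. *)
apply: (@le_lt_trans _ _ (h * (`|v| + `|w| + 1))).
  by rewrite (ler_wpM2l (ltW h0))// lerDl.
rewrite -ltr_pdivlMr ?ltr_wpDl ?addr_ge0//.
near: h; apply: nbhs_right_lt.
by rewrite divr_gt0// ltr_wpDl ?addr_ge0.
Unshelve. all: by end_near. Qed.

(** The same second difference is [h ^+ 2] times a value of [fvw] and also [h ^+ 2] times a value of
    [fwv], at two points of the parallelogram spanned at [x] by [h *: v] and [h *: w]. As h tends to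
    0, continuity at [x] identifies the two limits. *)
Lemma schwarz f fv fw fvw fwv x v w :
  (\forall y \near x, is_derive y v f (fv y) /\ is_derive y w fv (fvw y)) ->
  (\forall y \near x, is_derive y w f (fw y) /\ is_derive y v fw (fwv y)) ->
  {for x, continuous fvw} -> {for x, continuous fwv} -> fvw x = fwv x.
Proof.
move=> dvw dwv cvw cwv; apply/eqP; rewrite -subr_eq0 -normr_le0.
apply/ler_addgt0Pr => e e0; rewrite add0r.
have e2 : 0 < e / 2 by rewrite divr_gt0.
have nvw : \forall y \near x, `|fvw x - fvw y| < e / 2.
  by move/cvgrPdist_lt: cvw; apply.
have nwv : \forall y \near x, `|fwv x - fwv y| < e / 2.
  by move/cvgrPdist_lt: cwv; apply.
pose on_square h (P : set V) v w := forall s t : R,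
  0 <= s <= h -> 0 <= t <= h -> P (s *: v + (t *: w + x)).
have [h [h0 Pv Pw Nv Nw]] : exists h : R, [/\ 0 < h,
    on_square h
      (fun y => is_derive y v f (fv y) /\ is_derive y w fv (fvw y)) v w,
    on_square h
      (fun y => is_derive y w f (fw y) /\ is_derive y v fw (fwv y)) w v,
    on_square h (fun y => `|fvw x - fvw y| < e / 2) v w &
    on_square h (fun y => `|fwv x - fwv y| < e / 2) w v].
  near (0 : R)^'+ => h; exists h; split.
  - by [].
  - by near: h; exact: (near_square v w dvw).
  - by near: h; exact: (near_square w v dwv).
  - by near: h; exact: (near_square v w nvw).
  - by near: h; exact: (near_square w v nwv).
have [s [t [sh th E1]]] := second_difference h0 Pv.
have [s' [t' [sh' th' E2]]] := second_difference h0 Pw.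
have lw a : 0 < a < h -> 0 <= a <= h by case/andP=> *; rewrite !ltW.
have E : fvw (s *: v + (t *: w + x)) = fwv (s' *: w + (t' *: v + x)).
  apply: (@mulfI _ (h ^+ 2)); first by rewrite expf_neq0// gt_eqF.
  by rewrite -E1 -E2 [h *: w + (h *: v + x)]addrCA; ring.
have := Nv s t (lw _ sh) (lw _ th).
have := Nw s' t' (lw _ sh') (lw _ th').
rewrite -E => A1 A2.
rewrite -(subrKA (fvw (s *: v + (t *: w + x)))).
rewrite (le_trans (ler_normD _ _))// [e]splitr lerD// ltW//.
by rewrite distrC.
Unshelve. all: by end_near. Qed.
End Calc.

(** * Derivatives of vector-valued maps; maps into a circle *)

Section CalcRow.
Variables (R : realType) (V : normedModType R).
Implicit Types x v : V.

Lemma is_derive_mxP m n (M : V -> 'M[R]_(m, n)) x v dM :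
  is_derive x v M dM <-> forall i j, is_derive x v (fun y => M y i j) (dM i j).
Proof.
split=> [[dF <-] i j|dF].
  have dFij := (derivable_mxP _ _ _).1 dF i j.
  by split=> //; rewrite derive_mx// mxE.
have D : derivable M x v by apply/derivable_mxP => i j; have [] := dF i j.
split=> //; rewrite derive_mx//; apply/matrixP => i j; rewrite mxE.
by have [] := dF i j.
Qed.

Lemma is_derive_dot n (f g : V -> 'rV[R]_n) x v df dg :
  is_derive x v f df -> is_derive x v g dg ->
  is_derive x v (fun y => dot (f y) (g y)) (dot df (g x) + dot (f x) dg).
Proof.
move=> /is_derive_mxP df' /is_derive_mxP dg'.
have -> : (fun y => dot (f y) (g y)) =
    \sum_(i < n) (fun y => f y 0 i * g y 0 i).
  by apply/funext => y; rewrite dotE fct_sumE.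
apply: is_derive_eq; rewrite !dotE -big_split; apply: eq_bigr => i _ /=.
by rewrite addrC /GRing.scale /= [g x 0 i * _]mulrC.
Qed.

Lemma is_derive_dual_part e (f g : V -> 'rV[R]_4) x v df dg :
  is_derive x v f df -> is_derive x v g dg ->
  is_derive x v (fun y => dual_part e (f y) (g y))
    (dual_part e df (g x) + dual_part e (f x) dg).
Proof.
move=> /is_derive_mxP df' /is_derive_mxP dg'; apply/is_derive_mxP => i k.
have -> : (fun y => dual_part e (f y) (g y) i k) = fun y => match val k with
         | 0 => wedge 0 1 (f y) (g y) + e * wedge 2 3 (f y) (g y)
         | 1 => wedge 0 2 (f y) (g y) - e * wedge 1 3 (f y) (g y)
         | _ => wedge 0 3 (f y) (g y) + e * wedge 1 2 (f y) (g y)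
         end by apply/funext => y; rewrite mxE.
rewrite !mxE /wedge.
by case: k => [[|[|[|//]]] k] /=; apply: is_derive_eq;
  rewrite /GRing.scale /=; ring.
Qed.

Lemma is_derive_unique (W : normedModType R) (f : V -> W) x v a b :
  is_derive x v f a -> is_derive x v f b -> a = b.
Proof. by move=> [_ <-] [_ <-]. Qed.

(* S/|S| moves on the circle of the unit vectors making a constant angle with n.
   The component T of n orthogonal to S is orthogonal to the derivatives of S,
   and it vanishes only if S/|S| is constantly n or - n. *)
Lemma circle_valued_jacobian (S : V -> 'rV[R]_3) (n : 'rV[R]_3) (c : R)
    x v w a b :
  dot n n = 1 ->
  (\forall y \near x, dot n (S y) ^+ 2 = c * dot (S y) (S y)) ->
  is_derive x v S a -> is_derive x w S b -> S x != 0 ->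
  det3 (S x) a b = 0.
Proof.
move=> n1 Sn Sa Sb S0.
have n0 : n != 0 by rewrite -dot_eq0 n1 oner_eq0.
have dS u d : is_derive x u S d -> dot n (S x) * dot n d = c * dot (S x) d.
  move=> Sd.
  have D1 : is_derive x u (fun y => dot n (S y) ^+ 2 - c * dot (S y) (S y))
      (2 * (dot n (S x) * dot n d - c * dot (S x) d)).
    have := is_derive_dot (is_derive_cst n x u) Sd.
    have := is_derive_dot Sd Sd => d1 d2.
    apply: is_derive_eq; rewrite /GRing.scale /= [dot d _]dotC.
    by rewrite dot0l; ring.
  have D2 : is_derive x u (fun y => dot n (S y) ^+ 2 - c * dot (S y) (S y)) 0.
    apply: near_eq_is_derive (is_derive_cst 0 x u).
    by near=> y; rewrite (near Sn y)// subrr.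
  have /eqP := is_derive_unique D1 D2.
  by rewrite mulf_eq0 pnatr_eq0 /= subr_eq0 => /eqP.
have Sx := nbhs_singleton Sn.
have SS0 : dot (S x) (S x) != 0 by rewrite dot_eq0.
(* Great circle: here c = 0, so S stays in the plane orthogonal to [n] near [x]. This case is
   separate because the orthogonality of T to the derivatives is obtained by cancelling <n, S>. *)
have [nS0|nS0] := eqVneq (dot n (S x)) 0.
  have c0 : c = 0.
    move/eqP: Sx; rewrite nS0 expr0n /= eq_sym mulf_eq0 (negbTE SS0) orbF.
    by move/eqP.
  have dS0 u d : is_derive x u S d -> dot n d = 0.
    move=> Sd; have := is_derive_dot (is_derive_cst n x u) Sd.
    rewrite dot0l add0r => D1.
    have D2 : is_derive x u (fun y => dot n (S y)) 0.
      apply: near_eq_is_derive (is_derive_cst 0 x u).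
      near=> y; apply/esym/eqP; rewrite -sqrf_eq0 (near Sn y)//.
      by rewrite c0 mul0r.
    exact: is_derive_unique D1 D2.
  by apply: (@det3_orthogonal _ n) => //; [exact: dS0 Sa|exact: dS0 Sb].
pose T := dot (S x) (S x) *: n - dot n (S x) *: S x.
have TS : dot T (S x) = 0 by rewrite dotBl !dotZl; ring.
have Td u d : is_derive x u S d -> dot T d = 0.
  move=> /dS nd; apply: (mulfI nS0); rewrite mulr0 dotBl !dotZl.
  rewrite mulrBr mulrCA nd [X in _ - X]mulrA -expr2 Sx; ring.
have [T0|T0] := eqVneq T 0; last first.
  by apply: (@det3_orthogonal _ T) => //; [exact: Td Sa|exact: Td Sb].
(* Degenerate circle: with c = 1 the hypothesis is equality in the Cauchy-Schwarz inequality, so S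
   is parallel to [n] near [x] and so are its derivatives. *)
have c1 : c = 1.
  apply: (mulIf SS0); rewrite -Sx mul1r.
  have : dot T n = 0 by rewrite T0 dot0l.
  rewrite dotBl !dotZl n1 mulr1 [dot (S x) n]dotC -expr2.
  by move=> /eqP; rewrite subr_eq0 => /eqP.
have Sn' : \forall y \near x, dot n (S y) *: n = S y.
  near=> y; apply/esym/eqP; rewrite -subr_eq0 -dot_eq0.
  rewrite !(dotBl, dotBr, dotZl, dotZr) n1 [dot (S y) n]dotC.
  rewrite (_ : dot (S y) (S y) = dot n (S y) ^+ 2); first by apply/eqP; ring.
  by rewrite (near Sn y)// c1 mul1r.
have da u d : is_derive x u S d -> d = dot n d *: n.
  move=> Sd; have : is_derive x u S (dot n d *: n).
    apply: (near_eq_is_derive Sn'); apply/is_derive_mxP => i j.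
    have := is_derive_dot (is_derive_cst n x u) Sd => d1.
    rewrite (_ : (fun y => _ i j) = (fun y => n i j * dot n (S y))); last first.
      by apply/funext => y; rewrite !mxE mulrC.
    apply: is_derive_eq; rewrite /GRing.scale /= !mxE.
    by rewrite dot0l add0r mulrC.
  exact: is_derive_unique Sd.
by rewrite (da _ _ Sa) (da _ _ Sb) det3_collinear.
Unshelve. all: by end_near. Qed.
End CalcRow.

(** * Smooth maps on open sets *)

Section Smooth.
Variables (R : realType) (m n : nat) (U : set 'rV[R]_m).
Implicit Types (F : 'rV[R]_m -> 'rV[R]_n).

Lemma smooth_derive F v : smooth_on U F -> smooth_on U ('D_v F).
Proof. by move=> FU k; have [_] := FU k.+1; exact. Qed.

Lemma smooth_differentiable F x : smooth_on U F -> U x -> differentiable F x.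
Proof. by move=> FU Ux; have [/(_ _ Ux)] := FU 1%N. Qed.

Lemma smooth_is_derive F x v :
  smooth_on U F -> U x -> is_derive x v F ('D_v F x).
Proof.
move=> FU Ux; apply/derivableP/diff_derivable.
exact: smooth_differentiable Ux.
Qed.

Lemma smooth_schwarz F x v w : open U -> smooth_on U F -> U x ->
  'D_v ('D_w F) x = 'D_w ('D_v F) x.
Proof.
move=> Uo FU Ux; apply/rowP => j.
have near_U : \forall y \near x, U y by exact: open_nbhs_nbhs.
have cont u u' : {for x, continuous (fun y => 'D_u ('D_u' F) y 0 j)}.
  apply: (@continuous_comp _ _ _ ('D_u ('D_u' F)) (fun M : 'rV[R]_n => M 0 j)).
    apply/differentiable_continuous/smooth_differentiable => //.
    by do 2 apply: smooth_derive.
  exact: coord_continuous.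
have D u u' : \forall y \near x,
    is_derive y u (fun y => F y 0 j) ('D_u F y 0 j) /\
    is_derive y u' (fun y => 'D_u F y 0 j) ('D_u' ('D_u F) y 0 j).
  near=> y; have Uy : U y by near: y.
  by split; apply: (is_derive_mxP _ _ _ _).1; apply: smooth_is_derive => //;
    exact: smooth_derive.
exact: schwarz (D w v) (D v w) (cont v w) (cont w v).
Unshelve. all: by end_near. Qed.
End Smooth.

(** * The Gauss equation in coordinates *)

(** The adjugate formula; in ['I_2], the index [1 - i] is the one different from [i]. *)
Lemma invmx22 (R : fieldType) (A : 'M[R]_2) : \det A != 0 ->
  invmx A = (\det A)^-1 *:
    \matrix_(i, j) (if i == j then A (1 - i) (1 - i) else - A i j).
Proof.
move=> A0; set B := _ *: _.
have AB : A *m B = 1%:M.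
  apply/matrixP => i j; rewrite !mxE sum_ord2 !mxE det_ord2.
  rewrite det_ord2 in A0.
  have e : (1 - 1 = 0 :> 'I_2) by apply: val_inj.
  have e' : (1 - 0 = 1 :> 'I_2) by apply: val_inj.
  by case: (ord2_cases i) (ord2_cases j) => -> [] -> /=; rewrite ?e ?e'; field.
have Au : A \in unitmx by rewrite unitmxE unitfE.
by rewrite -[RHS](mulKmx Au) AB mulmx1.
Qed.

Lemma cramer22 (R : fieldType) (A : 'M[R]_2) (c : 'I_2 -> R) k : \det A != 0 ->
  \sum_(l < 2) invmx A k l * c l = (\det A)^-1 *
    ((if k == 0 then A (1 - k) (1 - k) else - A k 0) * c 0
     + (if k == 1 then A (1 - k) (1 - k) else - A k 1) * c 1).
Proof. by move=> A0; rewrite invmx22// sum_ord2 !mxE -!mulrA -mulrDr. Qed.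

Section Gram.
Variables (R : realType) (n : nat).
Implicit Types (a : 'I_2 -> 'rV[R]_n) (b : 'I_2 -> 'I_2 -> 'rV[R]_n).

Lemma det_gram_matrix a :
  \det (\matrix_(i < 2, j < 2) dot (a i) (a j))
  = dot (a 0) (a 0) * dot (a 1) (a 1) - dot (a 0) (a 1) ^+ 2.
Proof. by rewrite det_ord2 !mxE (dotC (a 1) (a 0)) expr2. Qed.

(** [a] stands for the first and [b] for the second partial derivatives, [c] for an entry of the
    inverse metric. By the symmetry of [b], the derivatives of the metric cancel in pairs up to
    twice one term. *)
Lemma koszul a b (c : R) i j l : (forall i j, b i j = b j i) ->
  2^-1 * (c * (dot (b i j) (a l) + dot (a j) (b i l)
               + (dot (b j i) (a l) + dot (a i) (b j l))
               - (dot (b l i) (a j) + dot (a i) (b l j))))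
  = c * dot (b i j) (a l).
Proof.
move=> bC; rewrite (bC j i) (bC l i) (bC l j) (dotC (a j)).
have : (2 : R) != 0 by rewrite pnatr_eq0.
by move: (dot _ _) (dot _ _) (dot _ _) => x y z ?; field.
Qed.
End Gram.

(* C stands for the Christoffel symbols, P l for pd 0 (C l 1 1), Q l for
   pd 1 (C l 0 1) and t for a third derivative, which cancels. *)
Lemma riemann_gram (R : realType) (G : 'M[R]_2) (a : 'I_2 -> 'rV[R]_4)
    (b : 'I_2 -> 'I_2 -> 'rV[R]_4) (t t' : 'rV[R]_4)
    (C : 'I_2 -> 'I_2 -> 'I_2 -> R) (P Q : 'I_2 -> R) :
  t' = t -> (forall i j, G i j = dot (a i) (a j)) ->
  \det G = gram (a 0) (a 1) -> gram (a 0) (a 1) != 0 ->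
  (forall i j, b i j = b j i) ->
  (forall k i j, C k i j = \sum_(l < 2) invmx G k l * dot (b i j) (a l)) ->
  (forall i j, \sum_(k < 2) G 0 k * C k i j = dot (b i j) (a 0)) ->
  \sum_(k < 2) G 0 k * Q k = dot t (a 0) + dot (b 0 1) (b 1 0)
    - \sum_(k < 2) (dot (b 1 0) (a k) + dot (a 0) (b 1 k)) * C k 0 1 ->
  \sum_(k < 2) G 0 k * P k = dot t' (a 0) + dot (b 1 1) (b 0 0)
    - \sum_(k < 2) (dot (b 0 0) (a k) + dot (a 0) (b 0 k)) * C k 1 1 ->
  (\sum_(l < 2) G 0 l *
     (P l - Q l + \sum_(m < 2) (C l 0 m * C m 1 1 - C l 1 m * C m 0 1)))
  / \det G * gram (a 0) (a 1) ^+ 2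
  = gauss_term (a 0) (a 1) (b 0 0) (b 0 1) (b 1 1).
Proof.
move=> -> Ga dG D0 bC Cdef L MQ MP.
(* Since the sum over k of [C k i j *: a k] is the tangential part of [b i j], the right side is
   <b00', b11'> - |b01'|^2, where ' denotes the normal component. *)
have -> : \sum_(l < 2) G 0 l *
     (P l - Q l + \sum_(m < 2) (C l 0 m * C m 1 1 - C l 1 m * C m 0 1))
  = dot (b 1 1) (b 0 0) - \sum_(k < 2) dot (b 0 0) (a k) * C k 1 1
    - dot (b 0 1) (b 0 1) + \sum_(k < 2) dot (b 0 1) (a k) * C k 0 1.
  have L2 i j : G 0 0 * C 0 i j + G 0 1 * C 1 i j = dot (b i j) (a 0).
    by rewrite -L sum_ord2.
  rewrite !sum_ord2 in MQ MP *.
  transitivity ((G 0 0 * P 0 + G 0 1 * P 1) - (G 0 0 * Q 0 + G 0 1 * Q 1)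
     + ((G 0 0 * C 0 0 0 + G 0 1 * C 1 0 0) * C 0 1 1
        - (G 0 0 * C 0 1 0 + G 0 1 * C 1 1 0) * C 0 0 1)
     + ((G 0 0 * C 0 0 1 + G 0 1 * C 1 0 1) * C 1 1 1
        - (G 0 0 * C 0 1 1 + G 0 1 * C 1 1 1) * C 1 0 1)).
    by ring.
  rewrite MQ MP !L2 (bC 1 0) !(dotC (a 0)).
  by ring.
have dG0 : \det G != 0 by rewrite dG.
have C0 i j : C 0 i j = (gram (a 0) (a 1))^-1 *
    (G 1 1 * dot (b i j) (a 0) - G 0 1 * dot (b i j) (a 1)).
  rewrite Cdef (cramer22 (fun l => dot (b i j) (a l)))// dG /= mulNr.
  by congr (_ * (G _ _ * _ - _)); apply: val_inj.
have C1 i j : C 1 i j = (gram (a 0) (a 1))^-1 *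
    (G 0 0 * dot (b i j) (a 1) - G 1 0 * dot (b i j) (a 0)).
  rewrite Cdef (cramer22 (fun l => dot (b i j) (a l)))// dG /= mulNr addrC.
  by congr (_ * (G _ _ * _ - _)); apply: val_inj.
rewrite !sum_ord2 !C0 !C1 !Ga dG /gauss_term /normal_gram (dotC (a 1) (a 0)).
rewrite (dotC (b 0 0) (b 1 1)) /gram in D0 *.
by field.
Qed.

Section GaussEquation.
Variables (R : realType) (U : set 'rV[R]_2) (F : 'rV[R]_2 -> 'rV[R]_4).
Hypotheses (U_open : open U) (F_smooth : smooth_on U F).
Hypothesis gram_neq0 : forall y, U y -> gram (pd 0 F y) (pd 1 F y) != 0.

Local Notation g := (induced_metric F).
Local Notation F1 i := (pd i F).
Local Notation F2 i j := (pd i (pd j F)).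

Lemma is_derive_pd i v y : U y -> is_derive y v (F1 i) ('D_v (F1 i) y).
Proof. by move=> Uy; apply: smooth_is_derive Uy; exact: smooth_derive. Qed.

Lemma is_derive_pd2 i j v y : U y -> is_derive y v (F2 i j) ('D_v (F2 i j) y).
Proof. by move=> Uy; apply: smooth_is_derive Uy; do 2 apply: smooth_derive. Qed.

Lemma pdC i j y : U y -> F2 i j y = F2 j i y.
Proof. exact: smooth_schwarz. Qed.

Lemma det_metric y : \det (g y) = gram (F1 0 y) (F1 1 y).
Proof. exact: (det_gram_matrix (fun i => F1 i y)). Qed.

Lemma is_derive_metric i j v y : U y -> is_derive y v (fun z => g z i j)
  (dot ('D_v (F1 i) y) (F1 j y) + dot (F1 i y) ('D_v (F1 j) y)).
Proof.
move=> Uy; rewrite (_ : (fun z => _) = fun z => dot (F1 i z) (F1 j z)).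
  exact: is_derive_dot (is_derive_pd _ _ Uy) (is_derive_pd _ _ Uy).
by apply/funext => z; rewrite mxE.
Qed.

Lemma pd_metric i j l y : U y -> pd i (fun z => g z j l) y =
  dot (F2 i j y) (F1 l y) + dot (F1 j y) (F2 i l y).
Proof.
by move=> Uy; exact: @derive_val _ _ _ _ _ _ _ (is_derive_metric _ _ _ Uy).
Qed.

Lemma christoffelE k i j y : U y -> christoffel g k i j y =
  \sum_(l < 2) invmx (g y) k l * dot (F2 i j y) (F1 l y).
Proof.
move=> Uy; rewrite /christoffel mulr_sumr; apply: eq_bigr => l _.
rewrite !pd_metric//.
exact: (koszul (fun i => F1 i y) _ _ _ _ (fun i j => pdC i j Uy)).
Qed.

Lemma metric_christoffel l i j y : U y ->
  \sum_(k < 2) g y l k * christoffel g k i j y = dot (F2 i j y) (F1 l y).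
Proof.
move=> Uy; pose b : 'cV[R]_2 := \col_k dot (F2 i j y) (F1 k y).
transitivity ((g y *m (invmx (g y) *m b)) l 0).
  rewrite [RHS]mxE; apply: eq_bigr => k _; rewrite christoffelE// [_ k 0]mxE.
  by congr (_ * _); apply: eq_bigr => p _; rewrite [b _ _]mxE.
rewrite mulmxA mulmxV ?mul1mx ?mxE//.
by rewrite unitmxE unitfE det_metric gram_neq0.
Qed.

Lemma derivable_christoffel k i j v y :
  U y -> derivable (christoffel g k i j) y v.
Proof.
move=> Uy.
pose h (z : 'rV[R]_2) (l : 'I_2) :=
  if k == l then g z (1 - k) (1 - k) else - g z k l.
(* By Cramer's rule, near [y] the symbol is a rational expression in differentiable functions, with
   the nonvanishing denominator det g. *)
pose G := fun z : 'rV[R]_2 => (\det (g z))^-1 *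
   (h z 0 * dot (F2 i j z) (F1 0 z) + h z 1 * dot (F2 i j z) (F1 1 z)).
suff GD : derivable G y v.
  apply: near_eq_derivable GD; near=> z.
  have Uz : U z by near: z; exact: open_nbhs_nbhs.
  rewrite christoffelE// (cramer22 (fun l => dot (F2 i j z) (F1 l z)))//.
  by rewrite det_metric gram_neq0.
have dg p q : derivable (fun z => g z p q) y v.
  by have [] := is_derive_metric p q v Uy.
have dh l : derivable (h ^~ l) y v.
  by rewrite /h; case: (k == l); [|apply: derivableN]; exact: dg.
have dF l : derivable (fun z => dot (F2 i j z) (F1 l z)) y v.
  by have [] := is_derive_dot (is_derive_pd2 i j v Uy) (is_derive_pd l v Uy).
apply: derivableM; last by apply: derivableD; apply: derivableM.
apply: derivableV; first by rewrite det_metric gram_neq0.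
have -> : (fun z => \det (g z)) =
    fun z => g z 0 0 * g z 1 1 - g z 0 1 * g z 1 0.
  by apply/funext => z; rewrite det_ord2.
by apply: derivableB; apply: derivableM; exact: dg.
Unshelve. all: by end_near. Qed.

(** The product rule applied to [metric_christoffel]: with the index lowered, derivatives of
    Christoffel symbols are found without differentiating the inverse metric. *)
Lemma metric_pd_christoffel l i j p y : U y ->
  \sum_(k < 2) g y l k * pd p (christoffel g k i j) y
  = dot (pd p (F2 i j) y) (F1 l y) + dot (F2 i j y) (F2 p l y)
    - \sum_(k < 2) (dot (F2 p l y) (F1 k y) + dot (F1 l y) (F2 p k y))
                   * christoffel g k i j y.
Proof.
move=> Uy; apply/eqP; rewrite eq_sym subr_eq -big_split /= eq_sym; apply/eqP.
have D1 := is_derive_dot (is_derive_pd2 i j (delta_mx 0 p) Uy)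
  (is_derive_pd l (delta_mx 0 p) Uy).
have dG k := derivableP (@derivable_christoffel k i j (delta_mx 0 p) y Uy).
have dg k := is_derive_metric l k (delta_mx 0 p) Uy.
have D2 := is_derive_sum (fun k => is_deriveM (dg k) (dG k)).
have E : \forall z \near y,
    (\sum_(k < 2) (fun z => g z l k * christoffel g k i j z)) z =
    dot (F2 i j z) (F1 l z).
  near=> z; rewrite fct_sumE metric_christoffel//.
  by near: z; exact: open_nbhs_nbhs.
rewrite -[RHS](is_derive_unique (near_eq_is_derive E D2) D1).
apply: eq_bigr => k _.
by rewrite /GRing.scale /= [christoffel _ _ _ _ _ * _]mulrC.
Unshelve. all: by end_near. Qed.

(** The theorema egregium multiplied by (det g)^2. *)
Lemma gauss_equation x : U x ->
  gauss_curvature g x * gram (F1 0 x) (F1 1 x) ^+ 2 =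
  gauss_term (F1 0 x) (F1 1 x) (F2 0 0 x) (F2 0 1 x) (F2 1 1 x).
Proof.
move=> Ux.
have third : pd 0 (F2 1 1) x = pd 1 (F2 0 1) x.
  by apply: smooth_schwarz Ux => //; exact: smooth_derive.
rewrite /gauss_curvature /riemann.
apply: (riemann_gram (a := fun i => F1 i x) (b := fun i j => F2 i j x)
  (t := pd 1 (F2 0 1) x) (t' := pd 0 (F2 1 1) x)
  (C := fun k i j => christoffel g k i j x)).
- exact: third.
- by move=> i j; rewrite mxE.
- by rewrite det_metric.
- exact: gram_neq0.
- by move=> i j; exact: pdC.
- by move=> k i j; exact: christoffelE.
- by move=> i j; exact: metric_christoffel.
- exact: metric_pd_christoffel.
- exact: metric_pd_christoffel.
Qed.
End GaussEquation.

(** * Volume form, orthonormal frames and normal curvature *)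

Lemma det_vol (R : realType) (E : 'M[R]_4) :
  \det E = vol (row 0 E) (row 1 E) (row 2 E) (row 3 E).
Proof.
(* Indexing by natural numbers lets the iterated [lift]s of the cofactors compute, so that [ring]
   sees equal entries as equal atoms. *)
have [a ->] : exists a : nat -> nat -> R, E = \matrix_(i, j) a i j.
  exists (fun i j => E (inord i) (inord j)).
  by apply/matrixP => i j; rewrite mxE !inord_val.
rewrite (expand_det_row _ 0) /vol /wedge !mxE !big_ord_recl big_ord0 /cofactor.
rewrite !(expand_det_row _ 0) !big_ord_recl !big_ord0 /cofactor !det_ord2 !mxE.
have e0 : nat_of_ord (0 : 'I_4) = 0%N by [].
have e1 : nat_of_ord (1 : 'I_4) = 1%N by [].
have e2 : nat_of_ord (2 : 'I_4) = 2%N by [].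
have e3 : nat_of_ord (3 : 'I_4) = 3%N by [].
have f0 : nat_of_ord (0 : 'I_2) = 0%N by [].
have f1 : nat_of_ord (1 : 'I_2) = 1%N by [].
have g0 : nat_of_ord (0 : 'I_3) = 0%N by [].
have l n (i : 'I_n) j : nat_of_ord (lift i j) = bump i j by [].
rewrite !(l, e0, e1, e2, e3, f0, f1, g0) /bump /= !exprS expr0.
by ring.
Qed.

Section Frames.
Variable R : realType.
Implicit Types x y p q r u v : 'rV[R]_4.

(* Laplace expansion of the Gram determinant of (x, y, u, v), (x, y, p, q). *)
Lemma vol_mul x y p q u v :
  dot u x = 0 -> dot v x = 0 -> dot u y = 0 -> dot v y = 0 ->
  vol x y u v * vol x y p q =
    gram x y * (dot u p * dot v q - dot u q * dot v p).
Proof.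
move=> ux vx uy vy.
pose m (a b c d : 'rV[R]_4) := dot a c * dot b d - dot a d * dot b c.
transitivity (m x y x y * m u v p q - m x y x p * m u v y q
  + m x y x q * m u v y p + m x y y p * m u v x q
  - m x y y q * m u v x p + m x y p q * m u v x y).
  rewrite /m /vol !dot4E /wedge.
  ring.
by rewrite /m ux vx uy vy !mul0r !mulr0 !subr0 !mulr0 !addr0 !subr0 (dotC y x).
Qed.

Lemma dual_part_lincomb e x y a b c d :
  dual_part e (a *: x + b *: y) (c *: x + d *: y) =
  (a * d - b * c) *: dual_part e x y.
Proof.
apply/rowP => k; rewrite !mxE /wedge !mxE.
by case: k => [[|[|[|//]]] i] /=; ring.
Qed.

Lemma mulmx_trE m n k (P : 'M[R]_(m, k)) (Q : 'M[R]_(n, k)) i j :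
  (P *m Q^T) i j = dot (row i P) (row j Q).
Proof. by rewrite dotE mxE; apply: eq_bigr => l _; rewrite !mxE. Qed.

Lemma gram_schmidt x y : 0 < gram x y ->
  exists A : 'M[R]_2, [/\ 0 < \det A, (\det A) ^+ 2 * gram x y = 1,
    dot (A 0 0 *: x + A 0 1 *: y) (A 0 0 *: x + A 0 1 *: y) = 1,
    dot (A 0 0 *: x + A 0 1 *: y) (A 1 0 *: x + A 1 1 *: y) = 0 &
    dot (A 1 0 *: x + A 1 1 *: y) (A 1 0 *: x + A 1 1 *: y) = 1].
Proof.
move=> D0; pose s := Num.sqrt (dot x x); pose t := Num.sqrt (gram x y).
have xx0 : 0 < dot x x.
  rewrite lt0r dot_ge0 andbT; apply: contraTneq D0 => xx0.
  by rewrite /gram xx0 mul0r add0r oppr_gt0 -leNgt sqr_ge0.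
have s0 : 0 < s by rewrite sqrtr_gt0.
have t0 : 0 < t by rewrite sqrtr_gt0.
have s2 : s ^+ 2 = dot x x by rewrite sqr_sqrtr// ltW.
have t2 : t ^+ 2 = gram x y by rewrite sqr_sqrtr// ltW.
have s0' : s != 0 by rewrite gt_eqF.
have t0' : t != 0 by rewrite gt_eqF.
(* Gram-Schmidt: e_1 = x/s and e_2 = (s^2 y - <x, y> x)/(s t), with s = |x| and st the norm of that
   numerator. *)
pose A : 'M[R]_2 := \matrix_(i, j) (if i == 0 then (if j == 0 then s^-1 else 0)
   else (if j == 0 then - dot x y / (s * t) else s / t)).
have dA : \det A = t^-1 by rewrite det_ord2 !mxE /=; field; rewrite s0' t0'.
exists A; rewrite dA !mxE /= !(dotDl, dotDr, dotZl, dotZr) (dotC y x).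
move: t2; rewrite /gram -s2 => t2.
have -> : dot y y = (t ^+ 2 + dot x y ^+ 2) / s ^+ 2 by rewrite t2; field.
by split; [rewrite invr_gt0|field|field|field|field]; rewrite ?s0' ?t0'.
Qed.

(* If e_i = A i 0 x + A i 1 y is an orthonormal frame, then
   A^T A = g^-1, which rewrites [h^3, h^4]_12 in terms of x, y. *)
Lemma ricci_term (T X : 'M[R]_(2, 4)) (b : 'I_2 -> 'I_2 -> 'rV[R]_4)
    (A : 'M[R]_2) (h : 'I_2 -> 'I_2 -> 'I_2 -> R) :
  gram (row 0 T) (row 1 T) != 0 -> orthonormal_rows (A *m T) -> T *m X^T = 0 ->
  b 1 0 = b 0 1 ->
  (forall s i j, h s i j =
     \sum_(k < 2) \sum_(l < 2) A i k * A j l * dot (b k l) (row s X)) ->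
  normal_term (row 0 T) (row 1 T) (b 0 0) (b 0 1) (b 1 1) = 0 ->
  h 0 0 0 * h 1 0 1 + h 0 0 1 * h 1 1 1
  - h 0 0 1 * h 1 0 0 - h 0 1 1 * h 1 0 1 = 0.
Proof.
move=> D0 orthoA TX bC hE N0.
have XT s i : dot (row s X) (row i T) = 0 by rewrite dotC -mulmx_trE TX mxE.
pose G := T *m T^T.
have AGA : A *m G *m A^T = 1%:M.
  rewrite /G !mulmxA -mulmxA -trmx_mul; apply/matrixP => i j.
  by rewrite mulmx_trE orthoA mxE.
have GE i j : G i j = dot (row i T) (row j T) by rewrite mulmx_trE.
move: {orthoA TX} (row 0 T) (row 1 T) (GE 0 0) (GE 0 1) (GE 1 0) (GE 1 1)
  (row 0 X) (row 1 X) (XT 0 0) (XT 1 0) (XT 0 1) (XT 1 1) (hE 0) (hE 1) D0 N0.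
move=> x y G00 G01 G10 G11 X0 X1 X0x X1x X0y X1y hE0 hE1 D0 N0.
have GB : G *m (A^T *m A) = 1%:M.
  by rewrite mulmxA; apply: mulmx1C; rewrite mulmxA.
have GBij i j : G i 0 * (A 0 0 * A 0 j + A 1 0 * A 1 j)
    + G i 1 * (A 0 1 * A 0 j + A 1 1 * A 1 j) = (i == j)%:R.
  have := congr1 (fun M : 'M[R]_2 => M i j) GB.
  rewrite [LHS]mxE [RHS]mxE sum_ord2 => <-.
  by rewrite ![(A^T *m A) _ _]mxE !sum_ord2 !mxE.
move: (GBij 0 0) (GBij 0 1) (GBij 1 0) (GBij 1 1).
rewrite G00 G01 G10 G11 (dotC y x) /= => e00 e01 e10 e11.
pose B i j := A 0 i * A 0 j + A 1 i * A 1 j.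
have DB00 : gram x y * B 0 0 = dot y y.
  transitivity (dot y y * (dot x x * B 0 0 + dot x y * B 1 0)
    - dot x y * (dot x y * B 0 0 + dot y y * B 1 0)).
    by rewrite /gram; ring.
  by rewrite [X in _ * X - _]e00 [X in _ - _ * X]e10; ring.
have DB01 : gram x y * B 0 1 = - dot x y.
  transitivity (dot y y * (dot x x * B 0 1 + dot x y * B 1 1)
    - dot x y * (dot x y * B 0 1 + dot y y * B 1 1)).
    by rewrite /gram; ring.
  by rewrite [X in _ * X - _]e01 [X in _ - _ * X]e11; ring.
have DB11 : gram x y * B 1 1 = dot x x.
  transitivity (dot x x * (dot x y * B 0 1 + dot y y * B 1 1)
    - dot x y * (dot x x * B 0 1 + dot x y * B 1 1)).
    by rewrite /gram; ring.
  by rewrite [X in _ * X - _]e11 [X in _ - _ * X]e01; ring.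
pose m p q := dot X0 p * dot X1 q - dot X0 q * dot X1 p.
have volm p q : vol x y X0 X1 * vol x y p q = gram x y * m p q.
  exact: vol_mul.
have Z : dot y y * m (b 0 0) (b 0 1) - dot x y * m (b 0 0) (b 1 1)
    + dot x x * m (b 0 1) (b 1 1) = 0.
  (* Multiplying [normal_term] by the volume of (x, y, X0, X1) turns each [vol] into a minor [m]
     taken in the normal frame, by [volm]. *)
  apply: (mulfI D0); rewrite mulr0.
  transitivity (vol x y X0 X1 * normal_term x y (b 0 0) (b 0 1) (b 1 1));
    last by rewrite N0 mulr0.
  transitivity (dot y y * (vol x y X0 X1 * vol x y (b 0 0) (b 0 1))
    - dot x y * (vol x y X0 X1 * vol x y (b 0 0) (b 1 1))
    + dot x x * (vol x y X0 X1 * vol x y (b 0 1) (b 1 1))).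
    by rewrite !volm; ring.
  by rewrite /normal_term; ring.
apply: (mulfI D0); rewrite mulr0.
(* With b_s the matrix of the <b k l, X_s>, one has h_s = A b_s A^T, so [h_0, h_1] = A (b_0 B b_1 -
   b_1 B b_0) A^T. The middle factor is skew, hence conjugation multiplies its only independent
   entry by det A. *)
transitivity ((A 0 0 * A 1 1 - A 0 1 * A 1 0)
  * (gram x y * B 0 0 * m (b 0 0) (b 0 1) + gram x y * B 0 1 * m (b 0 0) (b 1 1)
     + gram x y * B 1 1 * m (b 0 1) (b 1 1))).
  rewrite !hE0 !hE1 !sum_ord2 /= bC /m /B !(dotC X0) !(dotC X1).
  by ring.
rewrite DB00 DB01 DB11 mulNr -[RHS](mulr0 (A 0 0 * A 1 1 - A 0 1 * A 1 0)).
by congr (_ * _); exact: Z.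
Qed.
End Frames.

(** * Compatible complex structures as unit (anti-)self-dual forms *)

Section ComplexStructure.
Variable R : realType.
Implicit Types (J : {linear 'rV[R]_4 -> 'rV[R]_4}) (X Y : 'rV[R]_4).

Lemma dot_complex_skew J X Y :
  compatible_complex_structure J -> dot (J X) Y = - dot (J Y) X.
Proof.
by move=> [J2 Jdot]; rewrite -Jdot J2 dotNl dotC.
Qed.

Definition row4 (a b c d : R) : 'rV[R]_4 :=
  \row_j match val j with 0 => a | 1 => b | 2 => c | _ => d end.

(* The skew endomorphism whose form is the (anti-)self-dual form of
   coordinates n. *)
Definition dual_endo e (n : 'rV[R]_3) X : 'rV[R]_4 :=
  row4 (- (X 0 1 * n 0 0 + X 0 2 * n 0 1 + X 0 3 * n 0 2))
    (X 0 0 * n 0 0 - e * (X 0 2 * n 0 2 - X 0 3 * n 0 1))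
    (X 0 0 * n 0 1 + e * (X 0 1 * n 0 2 - X 0 3 * n 0 0))
    (X 0 0 * n 0 2 - e * (X 0 1 * n 0 1 - X 0 2 * n 0 0)).

Lemma dot_dual_endo (n : 'rV[R]_3) e X Y :
  dot (dual_endo e n X) Y = dot n (dual_part e X Y).
Proof. by rewrite dot4E dot3E !mxE /wedge /=; ring. Qed.

(* The sign e is the Pfaffian of the matrix of J. *)
Lemma complex_structure_dual J : compatible_complex_structure J ->
  exists n : 'rV[R]_3, exists2 e : R, dot n n = 1 /\ e ^+ 2 = 1 &
    forall X, J X = dual_endo e n X.
Proof.
move=> cJ; have [J2 Jdot] := cJ.
have [M JM] : exists M : 'M[R]_4, forall X, J X = X *m M.
  by exists (lin1_mx J) => X; rewrite mul_rV_lin1.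
have MT : M^T = - M.
  apply/matrixP => i j; rewrite [LHS]mxE [RHS]mxE.
  have := dot_complex_skew (delta_mx 0 i) (delta_mx 0 j) cJ.
  have dd (v : 'rV[R]_4) k : dot v (delta_mx 0 k) = v 0 k.
    rewrite dotE (bigD1 k)//= mxE !eqxx mulr1 big1 ?addr0// => l lk.
    by rewrite mxE eqxx (negbTE lk) mulr0.
  by rewrite !dd !JM -!rowE !mxE => ->; rewrite opprK.
have skew i j : M j i = - M i j.
  by have := congr1 (fun A : 'M[R]_4 => A i j) MT; rewrite !mxE.
have MM : M *m M = - 1%:M.
  by apply/row_matrixP => i; rewrite !rowE mulmxA -!JM J2 mulmxN mulmx1.
have diag0 i : M i i = 0 by have := skew i i; lra.
have MMij i j : M i 0 * M 0 j + M i 1 * M 1 j + M i 2 * M 2 j + M i 3 * M 3 j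
   = - (i == j)%:R.
  by have := congr1 (fun A : 'M[R]_4 => A i j) MM; rewrite !mxE sum_ord4.
set a := M 0 1; set b := M 0 2; set c := M 0 3.
pose d := M 1 2; pose e := M 1 3; pose f := M 2 3.
have E10 : M 1 0 = - a by exact: skew.
have E20 : M 2 0 = - b by exact: skew.
have E30 : M 3 0 = - c by exact: skew.
have E21 : M 2 1 = - d by exact: skew.
have E31 : M 3 1 = - e by exact: skew.
have E32 : M 3 2 = - f by exact: skew.
move: (MMij 0 0) (MMij 1 1) (MMij 2 2) (MMij 3 3) (MMij 0 1) (MMij 0 2)
  (MMij 0 3) (MMij 1 2) (MMij 1 3) (MMij 2 3).
rewrite !diag0 E10 E20 E30 E21 E31 E32 -/a -/b -/c -/d -/e -/f /=.
move=> m00 m11 m22 m33 m01 m02 m03 m12 m13 m23.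
(* A skew M times its Hodge dual is -p times the identity, p being the Pfaffian; as M^2 = -1, the
   dual of M is p M. The three equations below are this equality entry by entry. In each, [h1],
   [h2], [h3] are quadratic relations multiplied by an entry, which leaves a problem linear in the
   monomials. *)
pose p := a * f - b * e + c * d.
have ef : f = p * a.
  have h1 : (a * b + e * f) * e = 0.
    by rewrite (_ : a * b + e * f = 0) ?mul0r//; lra.
  have h2 : (a * c - d * f) * d = 0.
    by rewrite (_ : a * c - d * f = 0) ?mul0r//; lra.
  have h3 : (a * a + d * d + e * e - 1) * f = 0.
    by rewrite (_ : a * a + d * d + e * e - 1 = 0) ?mul0r//; lra.
  by rewrite /p; lra.
have ee : e = - (p * b).
  have h1 : (a * b + e * f) * f = 0.
    by rewrite (_ : a * b + e * f = 0) ?mul0r//; lra.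
  have h2 : (b * c + d * e) * d = 0.
    by rewrite (_ : b * c + d * e = 0) ?mul0r//; lra.
  have h3 : (b * b + d * d + f * f - 1) * e = 0.
    by rewrite (_ : b * b + d * d + f * f - 1 = 0) ?mul0r//; lra.
  by rewrite /p; lra.
have ed : d = p * c.
  have h1 : (a * c - d * f) * f = 0.
    by rewrite (_ : a * c - d * f = 0) ?mul0r//; lra.
  have h2 : (b * c + d * e) * e = 0.
    by rewrite (_ : b * c + d * e = 0) ?mul0r//; lra.
  have h3 : (c * c + e * e + f * f - 1) * d = 0.
    by rewrite (_ : c * c + e * e + f * f - 1 = 0) ?mul0r//; lra.
  by rewrite /p; lra.
have p2 : p ^+ 2 = 1.
  have h1 : p * p = f * f + e * e + d * d.
    rewrite {2}/p mulrDr mulrBr !mulrA -ef -ed.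
    by rewrite (_ : p * b = - e) ?ee ?opprK//; ring.
  by rewrite expr2 h1; lra.
exists (\row_k M 0 (lift 0 k)), p.
  split=> //; rewrite dot3E !mxE.
  transitivity (a * a + b * b + c * c); last by lra.
  by congr (M _ _ * M _ _ + M _ _ * M _ _ + M _ _ * M _ _); apply: val_inj.
move=> X.
have n0 : (\row_k M 0 (lift 0 k)) 0 (0 : 'I_3) = a.
  by rewrite mxE; congr (M _ _); apply: val_inj.
have n1 : (\row_k M 0 (lift 0 k)) 0 (1 : 'I_3) = b.
  by rewrite mxE; congr (M _ _); apply: val_inj.
have n2 : (\row_k M 0 (lift 0 k)) 0 (2 : 'I_3) = c.
  by rewrite mxE; congr (M _ _); apply: val_inj.
rewrite /dual_endo n0 n1 n2 JM; apply/rowP => j; rewrite !mxE sum_ord4.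
have [->|->|->|->] := ord4_cases j.
- by rewrite diag0 E10 E20 E30 /=; ring.
- by rewrite diag0 E21 E31 -/a -/d -/e ed ee /=; ring.
- by rewrite diag0 E32 -/b -/d -/f ed ef /=; ring.
- by rewrite diag0 -/c -/e -/f ee ef /=; ring.
Qed.

Lemma unit_orthogonal (n : 'rV[R]_3) :
  exists2 y : 'rV[R]_3, dot y y = 1 & dot n y = 0.
Proof.
have [r0|r0] := eqVneq (n 0 0 ^+ 2 + n 0 1 ^+ 2) 0.
  exists (delta_mx 0 0); rewrite dot3E !mxE /= ?mulr1 ?mulr0 ?addr0//.
  apply/eqP; rewrite -sqrf_eq0.
  by move/eqP: r0; rewrite paddr_eq0 ?sqr_ge0// => /andP[].
pose s := Num.sqrt (n 0 0 ^+ 2 + n 0 1 ^+ 2).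
have s2 : s ^+ 2 = n 0 0 ^+ 2 + n 0 1 ^+ 2.
  by rewrite sqr_sqrtr// addr_ge0 ?sqr_ge0.
have s0 : s != 0 by rewrite -sqrf_eq0 s2.
exists (\row_k match val k with 0 => - n 0 1 / s | 1 => n 0 0 / s | _ => 0 end).
  rewrite dot3E !mxE /=.
  transitivity ((n 0 0 ^+ 2 + n 0 1 ^+ 2) / s ^+ 2); first by field.
  by rewrite s2 divff.
by rewrite dot3E !mxE /=; field.
Qed.

(** [J_plus] and [J_minus] constrain the sign of every J-basis, so a single one with determinant [e]
    is enough to decide which [e] occurs. *)
Lemma J_basis_det J : compatible_complex_structure J ->
  exists n : 'rV[R]_3, exists2 e : R,
    [/\ dot n n = 1, e ^+ 2 = 1 &
        forall X Y, dot (J X) Y = dot n (dual_part e X Y)]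
    & exists2 E, J_basis J E & \det E = e.
Proof.
move=> cJ; have [J2 Jdot] := cJ.
have [n [e [n1 e2] JE]] := complex_structure_dual cJ.
exists n, e; first by split=> // X Y; rewrite JE dot_dual_endo.
have [y y1 ny] := unit_orthogonal n.
pose x0 : 'rV[R]_4 := row4 1 0 0 0.
(* [J x0] is the row (0, n), so y orthogonal to [n] makes [y0] orthogonal to both [x0] and
   [J x0]. *)
pose y0 : 'rV[R]_4 := row4 0 (y 0 0) (y 0 1) (y 0 2).
have skew X : dot (J X) X = 0 by have := dot_complex_skew X X cJ; lra.
have xx : dot x0 x0 = 1 by rewrite dot4E !mxE /=; ring.
have yy : dot y0 y0 = 1 by rewrite -y1 dot4E dot3E !mxE /=; ring.
have xy : dot x0 y0 = 0 by rewrite dot4E !mxE /=; ring.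
have Jxy : dot (J x0) y0 = 0.
  by rewrite -ny JE dot_dual_endo !dot3E !mxE /wedge !mxE /=; ring.
have Jyx : dot (J y0) x0 = 0 by have := dot_complex_skew x0 y0 cJ; lra.
have JJ X Y : dot (J X) (J Y) = dot X Y by [].
pose E : 'M[R]_4 := \matrix_(i < 4)
  match val i with 0 => x0 | 1 => J x0 | 2 => y0 | _ => J y0 end.
have E0 : row 0 E = x0 by rewrite rowK.
have E1 : row 1 E = J x0 by rewrite rowK.
have E2 : row 2 E = y0 by rewrite rowK.
have E3 : row 3 E = J y0 by rewrite rowK.
exists E.
  split; rewrite ?E0 ?E1 ?E2 ?E3//.
  have sym (X Y : 'rV[R]_4) : dot X Y = 0 -> dot Y X = 0 by rewrite dotC.
  move=> i j.
  have [->|->|->|->] := ord4_cases i; have [->|->|->|->] := ord4_cases j;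
    rewrite ?E0 ?E1 ?E2 ?E3 ?JJ ?xx ?yy //=; by [|exact: sym].
rewrite det_vol E0 E1 E2 E3 !JE /dual_endo /vol /wedge !mxE /=.
transitivity (e * (dot n n * dot y y - dot n y ^+ 2)).
  by rewrite !dot3E; ring.
by rewrite n1 y1 ny; ring.
Qed.

Lemma J_plus_form J : J_plus J -> exists2 n : 'rV[R]_3, dot n n = 1 &
  forall X Y, dot (J X) Y = dot n (dual_part 1 X Y).
Proof.
move=> [cJ pos]; have [n [e [n1 e2 JE] [E EJ dE]]] := J_basis_det cJ.
exists n => // X Y; rewrite JE.
move: e2 (pos _ EJ) => /eqP; rewrite dE sqrf_eq1 => /orP[/eqP->//|/eqP->].
by rewrite ltr0N1.
Qed.

Lemma J_minus_form J : J_minus J -> exists2 n : 'rV[R]_3, dot n n = 1 &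
  forall X Y, dot (J X) Y = dot n (dual_part (-1) X Y).
Proof.
move=> [cJ neg]; have [n [e [n1 e2 JE] [E EJ dE]]] := J_basis_det cJ.
exists n => // X Y; rewrite JE.
move: e2 (neg _ EJ) => /eqP; rewrite dE sqrf_eq1 => /orP[/eqP->|/eqP->//].
by rewrite ltr10.
Qed.
End ComplexStructure.

Lemma acos_eq_cos (R : realType) (x t : R) :
  -1 <= x <= 1 -> acos x = t -> x = cos t.
Proof. by move=> x1 <-; rewrite acosK// in_itv. Qed.

Lemma dot_unit_bound (R : realType) n (u v : 'rV[R]_n) :
  dot u u = 1 -> dot v v = 1 -> -1 <= dot u v <= 1.
Proof.
move=> u1 v1; have := dot_ge0 (u - v); have := dot_ge0 (u + v).
rewrite !(dotBl, dotBr, dotDl, dotDr) u1 v1 (dotC v u) => h1 h2.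
by apply/andP; split; lra.
Qed.

Lemma derive_pd (R : realType) n (G : 'rV[R]_2 -> 'rV[R]_n) (v x : 'rV[R]_2) :
  differentiable G x -> 'D_v G x = v 0 0 *: pd 0 G x + v 0 1 *: pd 1 G x.
Proof.
move=> dG; rewrite /pd !deriveE//.
rewrite {1}(_ : v = v 0 0 *: delta_mx 0 0 + v 0 1 *: delta_mx 0 1).
  by rewrite linearD !linearZ.
by rewrite {1}[v]row_sum_delta sum_ord2.
Qed.

Lemma scale_sum2 (R : comNzRingType) (V : lmodType R) (v w : 'I_2 -> R)
    (d : 'I_2 -> V) (b : 'I_2 -> 'I_2 -> V) :
  (forall l, d l = v 0 *: b 0 l + v 1 *: b 1 l) ->
  w 0 *: d 0 + w 1 *: d 1 = \sum_(k < 2) \sum_(l < 2) (v k * w l) *: b k l.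
Proof.
move=> dE; rewrite !sum_ord2 !dE !scalerDr !scalerA !(mulrC (w _)).
by rewrite addrACA.
Qed.

Lemma dot_sum2 (R : realType) n (a : 'I_2 -> 'I_2 -> R)
    (b : 'I_2 -> 'I_2 -> 'rV[R]_n) u :
  dot (\sum_(k < 2) \sum_(l < 2) a k l *: b k l) u =
  \sum_(k < 2) \sum_(l < 2) a k l * dot (b k l) u.
Proof. by rewrite !sum_ord2 !dotDl !dotZl. Qed.

Lemma dot_normal_part (R : realType) (T X : 'M[R]_(2, 4)) u s :
  T *m X^T = 0 -> dot (normal_part T u) (row s X) = dot u (row s X).
Proof.
move=> TX; rewrite /normal_part dotBl -[RHS]subr0; congr (_ - _).
rewrite /dot -mulmxA tr_row (_ : T *m col s X^T = 0) ?mulmx0 ?mxE//.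
by rewrite colE mulmxA TX mul0mx.
Qed.

(** * Slant immersions in a chart *)

Section Surface.
Variables (R : realType) (N : oriented_surface R) (f : N -> 'rV[R]_4).
Hypothesis f_immersion : immersion f.
Variables (c : chart R N) (c_atlas : atlas c).

Local Notation U := (cmap c @` cdom c).
Local Notation F := (local_rep f c).
Local Notation jet2 term x := (term (pd 0 F x) (pd 1 F x)
  (pd 0 (pd 0 F) x) (pd 0 (pd 1 F) x) (pd 1 (pd 1 F) x)).

Lemma local_rep_smooth : smooth_on U F.
Proof. by have [] := f_immersion c_atlas. Qed.

Lemma row_jacobian i y : U y -> row i ('J F y) = pd i F y.
Proof.
move=> Uy; rewrite rowE /pd deriveEjacobian//.
exact: smooth_differentiable local_rep_smooth Uy.
Qed.

Lemma mul_jacobian (v : 'rV[R]_2) y : U y ->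
  v *m 'J F y = v 0 0 *: pd 0 F y + v 0 1 *: pd 1 F y.
Proof.
move=> Uy; have dF := smooth_differentiable local_rep_smooth Uy.
by rewrite -deriveEjacobian// derive_pd.
Qed.

Lemma gram_gt0 y : U y -> 0 < gram (pd 0 F y) (pd 1 F y).
Proof.
move=> Uy; have [p cp yE] := Uy.
have [_ inj] := f_immersion c_atlas; have {inj} := inj p cp.
rewrite yE => inj.
have lin (v : 'rV[R]_2) : v 0 0 *: pd 0 F y + v 0 1 *: pd 1 F y = 0 -> v = 0.
  rewrite -mul_jacobian// /jacobian mul_rV_lin1 => v0.
  by apply: inj; rewrite v0 linear0.
move: (pd 0 F y) (pd 1 F y) lin => u v lin.
have row2 a b : a *: u + b *: v = 0 -> a = 0 /\ b = 0.
  move=> ab; have E : \row_j (if j == 0 then a else b) = 0 :> 'rV[R]_2.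
    by apply: lin; rewrite !mxE.
  by move/rowP: E => E; have := E 0; have := E 1; rewrite !mxE /=.
have uu0 : dot u u != 0.
  rewrite dot_eq0; apply/eqP => u0; have [] := row2 1 0.
    by rewrite u0 scaler0 scale0r addr0.
  by move/eqP; rewrite oner_eq0.
have uu : 0 < dot u u by rewrite lt0r uu0 dot_ge0.
(* This multiple of the component of v orthogonal to u has squared norm |u|^2 [gram u v]. *)
have w0 : dot u u *: v - dot u v *: u != 0.
  apply/eqP => w; have [] := row2 (- dot u v) (dot u u).
    by rewrite scaleNr addrC.
  by move=> _ /eqP; rewrite (negbTE uu0).
have : 0 < dot (dot u u *: v - dot u v *: u) (dot u u *: v - dot u v *: u).
  by rewrite lt0r dot_ge0 dot_eq0 w0.
rewrite (_ : dot _ _ = dot u u * gram u v) ?pmulr_rgt0//.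
by rewrite !(dotBl, dotBr, dotZl, dotZr) (dotC v u) /gram; ring.
Qed.

(** For the frame with matrix A given by Gram-Schmidt, cos theta = <J e_1, e_2> = det A <n, S>,
    while (det A)^2 |S|^2 = 1; squaring eliminates A. *)
Lemma slant_gauss_map (J : {linear 'rV[R]_4 -> 'rV[R]_4}) (n : 'rV[R]_3) e :
  compatible_complex_structure J -> e ^+ 2 = 1 ->
  (forall X Y, dot (J X) Y = dot n (dual_part e X Y)) -> slant f J ->
  exists k, forall y, U y ->
    dot n (dual_part e (pd 0 F y) (pd 1 F y)) ^+ 2 =
    k * dot (dual_part e (pd 0 F y) (pd 1 F y))
            (dual_part e (pd 0 F y) (pd 1 F y)).
Proof.
move=> [J2 Jdot] e2 Jn [theta thetaP]; exists (cos theta ^+ 2) => y Uy.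
have [p cp yE] := Uy.
have [A [detA dA2 A00 A01 A11]] := gram_schmidt (gram_gt0 Uy).
pose E := A *m 'J F y.
have rowEA i : row i E = A i 0 *: pd 0 F y + A i 1 *: pd 1 F y.
  by rewrite /E row_mul mul_jacobian// !mxE.
have ortho : orthonormal_rows E.
  move=> i j; have [->|->] := ord2_cases i; have [->|->] := ord2_cases j;
    rewrite !rowEA//.
  by rewrite dotC.
have pos : positive_tangent_basis f p E.
  exists c; split; [exact: c_atlas|exact: cp|exists A; first exact: detA].
  exact: (congr1 (fun z => A *m 'J F z) (esym yE)).
have := thetaP _ _ pos ortho; rewrite /alpha => /acos_eq_cos <-; last first.
  apply: dot_unit_bound; last exact: ortho.
  by rewrite Jdot; exact: ortho.
rewrite Jn !rowEA dual_part_lincomb dotZr dot_dual_part//.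
by rewrite -det_ord2 exprMn mulrAC dA2 mul1r.
Qed.

Lemma slant_jacobian x J (n : 'rV[R]_3) e : U x ->
  compatible_complex_structure J -> e ^+ 2 = 1 -> dot n n = 1 ->
  (forall X Y, dot (J X) Y = dot n (dual_part e X Y)) -> slant f J ->
  e * jet2 (@gauss_term R) x + jet2 (@normal_term R) x = 0.
Proof.
move=> Ux cJ e2 n1 Jn sJ.
have [k kP] := slant_gauss_map cJ e2 Jn sJ.
have D i j := is_derive_pd local_rep_smooth j (delta_mx 0 i) Ux.
have C : pd 0 (pd 1 F) x = pd 1 (pd 0 F) x.
  exact: (pdC (@cimage_open _ _ c) local_rep_smooth).
(* [det3_dual_part] has one mixed derivative [q] in both columns, so the two orders of
   differentiation must be given the same form. *)
have D10 : is_derive x (delta_mx 0 1) (pd 0 F) (pd 0 (pd 1 F) x).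
  by rewrite C; exact: D 1 0.
have nearS : \forall y \near x,
    dot n (dual_part e (pd 0 F y) (pd 1 F y)) ^+ 2 =
    k * dot (dual_part e (pd 0 F y) (pd 1 F y))
            (dual_part e (pd 0 F y) (pd 1 F y)).
  near=> y; apply: kP; near: y.
  exact: open_nbhs_nbhs (conj (@cimage_open _ _ c) Ux).
have S0 : dual_part e (pd 0 F x) (pd 1 F x) != 0.
  by rewrite -dot_eq0 (dot_dual_part _ _ e2); exact: lt0r_neq0 (gram_gt0 Ux).
have J0 := circle_valued_jacobian n1 nearS
  (is_derive_dual_part e (D 0 0) (D 0 1)) (is_derive_dual_part e D10 (D 1 1))
  S0.
exact: etrans (esym (det3_dual_part _ _ _ _ _ e2)) J0.
Unshelve. all: by end_near. Qed.

Lemma doubly_slant_terms x : doubly_slant f -> U x ->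
  jet2 (@gauss_term R) x = 0 /\ jet2 (@normal_term R) x = 0.
Proof.
move=> [[Jp Jp_plus sp] [Jm Jm_minus sm]] Ux.
have [np np1 npE] := J_plus_form Jp_plus.
have [nm nm1 nmE] := J_minus_form Jm_minus.
have m1 : (-1 : R) ^+ 2 = 1 by rewrite sqrrN expr1n.
have := slant_jacobian Ux (proj1 Jp_plus) (expr1n _ 2) np1 npE sp.
have := slant_jacobian Ux (proj1 Jm_minus) m1 nm1 nmE sm.
move: (gauss_term _ _ _ _ _) (normal_term _ _ _ _ _) => G W E1 E2.
by split; lra.
Qed.

Lemma derive2_pd v w x : U x ->
  'D_v ('D_w F) x =
  \sum_(k < 2) \sum_(l < 2) (v 0 k * w 0 l) *: pd k (pd l F) x.
Proof.
move=> Ux.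
(* Differentiating ['D_w F] again requires its expansion in the coordinate derivatives on a whole
   neighbourhood, not just at [x]. *)
have near_pd : \forall y \near x,
    (w 0 0 \*: pd 0 F + w 0 1 \*: pd 1 F) y = 'D_w F y.
  near=> y; have Uy : U y.
    by near: y; exact: open_nbhs_nbhs (conj (@cimage_open _ _ c) Ux).
  by rewrite (derive_pd _ (smooth_differentiable local_rep_smooth Uy)).
have D l := is_derive_pd local_rep_smooth l v Ux.
have DD := is_deriveD (is_deriveZ (w 0 0) (D 0)) (is_deriveZ (w 0 1) (D 1)).
have [_ ->] := near_eq_is_derive near_pd DD.
apply: (@scale_sum2 _ _ (v 0) (w 0) (fun l => 'D_v (pd l F) x)
  (fun k l => pd k (pd l F) x)) => l.
exact: (derive_pd v
  (smooth_differentiable (smooth_derive (delta_mx 0 l) local_rep_smooth) Ux)).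
Unshelve. all: by end_near. Qed.

Lemma second_fundamental_form_normal x v w (X : 'M[R]_(2, 4)) s :
  U x -> 'J F x *m X^T = 0 ->
  dot (second_fundamental_form F x v w) (row s X) =
  \sum_(k < 2) \sum_(l < 2) v 0 k * w 0 l * dot (pd k (pd l F) x) (row s X).
Proof.
move=> Ux TX; rewrite /second_fundamental_form (dot_normal_part _ _ TX).
rewrite (derive2_pd _ _ Ux).
exact: (dot_sum2 (fun k l => v 0 k * w 0 l) (fun k l => pd k (pd l F) x)).
Qed.

End Surface.

Unset Implicit Arguments.

Theorem theorem4p1 (R : realType) (N : oriented_surface R)
    (f : N -> 'rV[R]_4) (f_immersion : immersion f)
    (f_doubly_slant : doubly_slant f)
    (c : chart R N) (c_atlas : atlas c) (p : N) (c_p : cdom c p) :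
  gauss_curvature (induced_metric (local_rep f c)) (cmap c p) = 0 /\
  (forall (A : 'M[R]_2) (X : 'M[R]_(2, 4)),
     orthonormal_frame (local_rep f c) (cmap c p) A X ->
     normal_curvature (local_rep f c) (cmap c p) A X = 0).
Proof.
have Ux : (cmap c @` cdom c) (cmap c p) by exists p.
have Fs := local_rep_smooth f_immersion c_atlas.
have [G0 W0] := doubly_slant_terms f_immersion c_atlas f_doubly_slant Ux.
have D0 y (Uy : (cmap c @` cdom c) y) :=
  lt0r_neq0 (gram_gt0 f_immersion c_atlas Uy).
split.
  apply: (mulIf (expf_neq0 2 (D0 _ Ux))); rewrite mul0r.
  exact: etrans (gauss_equation (@cimage_open _ _ c) Fs D0 Ux) G0.
move=> A X [orthoA _ TX].
have rowJ i := row_jacobian f_immersion c_atlas i Ux.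
apply: (ricci_term (T := 'J (local_rep f c) (cmap c p)) (X := X) (A := A)
  (b := fun k l => pd k (pd l (local_rep f c)) (cmap c p))
  (h := fun r i j => dot (second_fundamental_form (local_rep f c) (cmap c p)
                            (row i A) (row j A)) (row r X))).
- by rewrite (rowJ 0) (rowJ 1); exact: D0.
- exact: orthoA.
- exact: TX.
- exact: (pdC (@cimage_open _ _ c) Fs).
- move=> s i j; apply: etrans
    (second_fundamental_form_normal f_immersion c_atlas _ _ s Ux TX) _.
  by apply: eq_bigr => k _; apply: eq_bigr => l _; rewrite !mxE.
- by rewrite (rowJ 0) (rowJ 1); exact: W0.
Qed.
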